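(* Let $m$ be a positive integer, and let $\alpha$ be a complex number with $\alpha\neq\frac12$. Then $$(-1)^{m+1}\frac{\alpha^{2m}-(\alpha-1)^{2m}}{4}\cdot\frac{\pi^{2m+2}}{(2m)!}+\sum_{k=1}^m(-1)^k\left(\alpha^{2k-1}+(\alpha-1)^{2k-1}\right)\frac{\pi^{2k}}{(2k-1)!}\,\lambda(2m-2k+2)=0.$$
   Context: The Dirichlet lambda function is $\lambda(s)=\sum_{n=0}^\infty\frac{1}{(2n+1)^s}$ for $\mathrm{Re}(s)>1$. *)

(* Defs.v *)
From Stdlib Require Import Reals Lra.
From Coquelicot Require Import Coquelicot.

Local Open Scope C_scope.

Definition Cexp (z : C) : C :=
  (exp (Re z) * cos (Im z), exp (Re z) * sin (Im z))%R.

(* Only meaningful for [0 < x]: [ln] takes the junk value 0 elsewhere. *)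
Definition RpowerC (x : R) (s : C) : C := Cexp (s * RtoC (ln x)).

(* [iota] returns the unique limit of the series when it converges, in
   particular whenever [1 < Re s]; the value is junk where it diverges. *)
Definition lambda (s : C) : C :=
  iota (fun l : C_CompleteNormedModule =>
    is_series (V := C_NormedModule)
      (fun n : nat => 1 / RpowerC (INR (2 * n + 1)) s) l).

Lemma RpowerC_nat (x : R) (n : nat) :
  (0 < x)%R -> RpowerC x (RtoC (INR n)) = RtoC x ^ n.
Proof.
intros Hx.
rewrite <- RtoC_pow, <- (Rpower_pow n x Hx).
unfold RpowerC, Cexp, Rpower, RtoC; simpl.
replace (INR n * 0 + 0 * ln x)%R with 0%R by ring.
replace (INR n * ln x - 0 * 0)%R with (INR n * ln x)%R by ring.
rewrite cos_0, sin_0. f_equal; ring.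
Qed.

Lemma lambda_unique (s l : C) :
  is_series (V := C_NormedModule)
    (fun n : nat => 1 / RpowerC (INR (2 * n + 1)) s) l -> lambda s = l.
Proof.
intros Hl.
apply (iota_unique (V := C_CompleteNormedModule)); [|exact Hl].
intros l' Hl'.
exact (filterlim_locally_unique (V := C_NormedModule) _ _ _ Hl' Hl).
Qed.

(* Main.v *)
Require Import Defs.
From Stdlib Require Import Reals Factorial.
From Coquelicot Require Import Coquelicot.
From Stdlib Require Import Lra Lia.

(** The identity is a Fourier cosine series evaluated in two ways.

    Let [q t = (alpha - 1 + t) ^ (2 m) / (2 m)!] on the unit interval, and let
    [a k] be the integral of [q t * cos ((2 k + 1) PI t)]. Repeated integration
    by parts ([cos_coef_appell]) expresses [a k] by the odd derivatives of [q]
    at both ends, that is by the numbers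
    [(alpha ^ (2 i - 1) + (alpha - 1) ^ (2 i - 1)) / (2 i - 1)!], divided by even
    powers of [(2 k + 1) PI]. Summing over [k] turns these powers into the values
    of lambda at [2 m - 2 i + 2], and yields the sum in the statement up to a
    factor [PI ^ (2 m + 2)] and a sign.

    On the other hand, for every twice continuously differentiable [f] whose
    cosine coefficients at the odd frequencies are summable, they add up to
    [(f 0 - f 1) / 4] ([cos_series_endpoints]); for [f = q] this is the isolated
    term of the statement. To see it, subtract a combination of [1],
    [cos (PI t)], [sin (PI t)] and [sin (2 PI t)], whose series are computed by
    hand, so as to reduce to a function with double zeros at 0 and 1. For such
    a function the partial sums of the series average to 0
    ([cos_series_zero]), because the doubly summed kernel is
    [(cos (PI t) - cos ((2 n + 3) PI t)) / (4 sin (PI t) ^ 2)] and the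
    denominator is absorbed by the function.

    The argument is carried out for real functions; a complex [alpha] is
    reached by taking the real part of [w * q] for an arbitrary complex
    weight [w]. *)

Open Scope R_scope.

(** * The odd frequencies and integration by parts *)

Definition freq (k : nat) : R := INR (2 * k + 1) * PI.

Lemma INR_odd (k : nat) : INR (2 * k + 1) = 2 * INR k + 1.
Proof. rewrite plus_INR, mult_INR; simpl; ring. Qed.

Lemma freq_shift (k : nat) : freq k = PI + 2 * INR k * PI.
Proof. unfold freq; rewrite INR_odd; ring. Qed.

Lemma INR_odd_ge1 (k : nat) : 1 <= INR (2 * k + 1).
Proof. rewrite INR_odd; pose proof (pos_INR k); lra. Qed.

Lemma freq_pos (k : nat) : 0 < freq k.
Proof.
  unfold freq; pose proof (INR_odd_ge1 k); pose proof PI_RGT_0; nra.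
Qed.

Lemma sin_freq (k : nat) : sin (freq k) = 0.
Proof. rewrite freq_shift, sin_period; exact sin_PI. Qed.

Lemma cos_freq (k : nat) : cos (freq k) = -1.
Proof. rewrite freq_shift, cos_period; exact cos_PI. Qed.

Lemma continuous_of_is_derive (f : R -> R) (t d : R) :
  is_derive f t d -> continuous f t.
Proof. intros H; apply (ex_derive_continuous f t); exists d; exact H. Qed.

Lemma cos_freq_is_derive (k : nat) (t : R) :
  is_derive (fun t => cos (freq k * t)) t (- freq k * sin (freq k * t)).
Proof. auto_derive; [trivial | ring]. Qed.

Lemma is_RInt_eq (f : R -> R) (a b I J : R) :
  is_RInt f a b I -> I = J -> is_RInt f a b J.
Proof. now intros H <-. Qed.

Lemma is_RInt_antiderivative (F f : R -> R) (a b l : R) :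
  (forall t, is_derive F t (f t)) -> (forall t, continuous f t) ->
  F b - F a = l -> is_RInt f a b l.
Proof.
  intros HF Hf <-.
  exact (is_RInt_derive (V := R_CompleteNormedModule) F f a b
           (fun t _ => HF t) (fun t _ => Hf t)).
Qed.

(** At an odd frequency the sine vanishes and the cosine is -1 at [t = 1], so
    two integrations by parts leave only the sum of the end slopes of [f].
    Keeping both integrals on the left serves the two cases used below: [f2]
    proportional to [f], and [f2] with a known integral. *)
Lemma is_RInt_by_parts (f f1 f2 : R -> R) (k : nat) :
  (forall t, is_derive f t (f1 t)) ->
  (forall t, is_derive f1 t (f2 t)) ->
  (forall t, continuous f2 t) ->
  is_RInt (fun t => (freq k ^ 2 * f t + f2 t) * cos (freq k * t)) 0 1
    (- (f1 1 + f1 0)).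
Proof.
  intros Hf Hf1 Hf2.
  apply is_RInt_antiderivative with
    (fun t => freq k * (f t * sin (freq k * t)) + f1 t * cos (freq k * t)).
  - intros t.
      pose proof (is_derive_unique _ _ _ (Hf t)) as E.
      pose proof (is_derive_unique _ _ _ (Hf1 t)) as E1.
      auto_derive.
      * repeat split; eexists; eauto.
      * change (Derive (fun x => f x) t) with (Derive f t).
        change (Derive (fun x => f1 x) t) with (Derive f1 t).
        rewrite E, E1. ring.
  - intros t.
      apply (continuous_mult (K := R_AbsRing)
               (fun t => freq k ^ 2 * f t + f2 t) (fun t => cos (freq k * t))).
      * apply (continuous_plus (fun t => freq k ^ 2 * f t) f2); [|apply Hf2].
        apply (continuous_mult (K := R_AbsRing) (fun _ => freq k ^ 2) f).
        -- apply continuous_const.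
        -- eapply continuous_of_is_derive, Hf.
      * eapply continuous_of_is_derive, cos_freq_is_derive.
  - rewrite !Rmult_0_r, !Rmult_1_r, sin_freq, cos_freq, sin_0, cos_0; ring.
Qed.

Lemma cos_coef_reduce (f f1 f2 : R -> R) (k : nat) (J : R) :
  (forall t, is_derive f t (f1 t)) ->
  (forall t, is_derive f1 t (f2 t)) ->
  (forall t, continuous f2 t) ->
  is_RInt (fun t => f2 t * cos (freq k * t)) 0 1 J ->
  is_RInt (fun t => f t * cos (freq k * t)) 0 1
    (- (f1 1 + f1 0 + J) / freq k ^ 2).
Proof.
  intros Hf Hf1 Hf2 HJ.
  pose proof (freq_pos k) as Hk.
  pose proof (is_RInt_by_parts f f1 f2 k Hf Hf1 Hf2) as H.
  pose proof (is_RInt_scal _ _ _ (/ freq k ^ 2) _ (is_RInt_minus _ _ _ _ _ _ H HJ)) as H'.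
  eapply is_RInt_ext in H'.
  - eapply is_RInt_eq; [exact H'|].
    unfold scal, minus, plus, opp; simpl; unfold mult; simpl. field. lra.
  - intros t _. unfold scal, minus, plus, opp; simpl; unfold mult; simpl.
    field. lra.
Qed.

(** The resonance [freq k = w] is excluded. Among the functions summed below
    it occurs only for [w = PI] and [k = 0], where an explicit primitive is
    used. *)
Lemma cos_coef_harmonic (f f1 : R -> R) (w : R) (k : nat) :
  freq k ^ 2 <> w ^ 2 ->
  (forall t, is_derive f t (f1 t)) ->
  (forall t, is_derive f1 t (- w ^ 2 * f t)) ->
  is_RInt (fun t => f t * cos (freq k * t)) 0 1
    (- (f1 1 + f1 0) / (freq k ^ 2 - w ^ 2)).
Proof.
  intros Hw Hf Hf1.
  assert (Hf2 : forall t, continuous (fun t => - w ^ 2 * f t) t).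
  { intros t. apply (continuous_mult (K := R_AbsRing) (fun _ => - w ^ 2) f).
    - apply continuous_const.
    - eapply continuous_of_is_derive, Hf. }
  pose proof (is_RInt_by_parts f f1 _ k Hf Hf1 Hf2) as H.
  pose proof (is_RInt_scal _ _ _ (/ (freq k ^ 2 - w ^ 2)) _ H) as H'.
  eapply is_RInt_ext in H'.
  - eapply is_RInt_eq; [exact H'|].
    unfold scal; simpl; unfold mult; simpl. field. lra.
  - intros t _. unfold scal; simpl; unfold mult; simpl. field. lra.
Qed.

(** * The sum of a cosine series over odd frequencies *)

(** Multiplying by [2 sin (PI t)] makes the sum telescope. *)
Lemma kernel_sum (n : nat) (t : R) :
  2 * sin (PI * t) * sum_n (fun k => cos (freq k * t)) n
  = sin (INR (2 * n + 2) * PI * t).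
Proof.
  induction n as [|n IH].
  - rewrite sum_O. unfold freq. simpl.
    replace ((1 + 1) * PI * t) with (2 * (PI * t)) by ring.
    rewrite sin_2a. replace (1 * PI * t) with (PI * t) by ring. ring.
  - rewrite sum_Sn. change plus with Rplus. rewrite Rmult_plus_distr_l, IH.
    replace (INR (2 * n + 2) * PI * t) with (freq (S n) * t - PI * t).
    2:{ unfold freq. rewrite !plus_INR, !mult_INR, (S_INR n); simpl; ring. }
    replace (INR (2 * S n + 2) * PI * t) with (freq (S n) * t + PI * t).
    2:{ unfold freq. rewrite !plus_INR, !mult_INR, (S_INR n); simpl; ring. }
    rewrite sin_plus, sin_minus. ring.
Qed.

(** A second summation telescopes once more, so the kernel of the sum of the
    partial sums is [O(1 / sin (PI t) ^ 2)] uniformly in [n]. *)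
Lemma kernel_double_sum (n : nat) (t : R) :
  4 * sin (PI * t) ^ 2
    * sum_n (fun j => sum_n (fun k => cos (freq k * t)) j) n
  = cos (PI * t) - cos (freq (S n) * t).
Proof.
  assert (H : forall j, 4 * sin (PI * t) ^ 2 * sum_n (fun k => cos (freq k * t)) j
    = cos (freq j * t) - cos (freq (S j) * t)).
  { intros j. transitivity (2 * sin (PI * t) * sin (INR (2 * j + 2) * PI * t)).
    - rewrite <- kernel_sum. ring.
    - replace (freq j * t) with (INR (2 * j + 2) * PI * t - PI * t).
      2:{ unfold freq. rewrite !plus_INR, !mult_INR; simpl; ring. }
      replace (freq (S j) * t) with (INR (2 * j + 2) * PI * t + PI * t).
      2:{ unfold freq. rewrite !plus_INR, !mult_INR, (S_INR j); simpl; ring. }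
      rewrite cos_plus, cos_minus. ring. }
  induction n as [|n IH].
  - rewrite sum_O, H. unfold freq at 1. simpl INR. do 2 f_equal. ring.
  - rewrite sum_Sn. change plus with Rplus.
    rewrite Rmult_plus_distr_l, IH, H. ring.
Qed.

Lemma is_RInt_sum_n (f : nat -> R -> R) (I : nat -> R) (a b : R) (n : nat) :
  (forall k, is_RInt (f k) a b (I k)) ->
  is_RInt (fun t => sum_n (fun k => f k t) n) a b (sum_n I n).
Proof.
  intros H. induction n as [|n IH].
  - rewrite sum_O. eapply is_RInt_ext; [|apply H].
    intros t _; rewrite sum_O; reflexivity.
  - rewrite sum_Sn. eapply is_RInt_ext.
    2:{ apply (is_RInt_plus _ _ _ _ _ _ IH (H (S n))). }
    intros t _; rewrite sum_Sn; reflexivity.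
Qed.

Lemma abs_le_quadratic (g g1 g2 : R -> R) (M : R) :
  (forall t, is_derive g t (g1 t)) ->
  (forall t, is_derive g1 t (g2 t)) ->
  (forall t, 0 <= t <= 1 -> Rabs (g2 t) <= M) ->
  g 0 = 0 -> g1 0 = 0 ->
  forall t, 0 <= t <= 1 -> Rabs (g t) <= M * t ^ 2.
Proof.
  intros Hg Hg1 HM g0 g10.
  assert (step : forall (h h1 : R -> R) (t : R), 0 <= t ->
    (forall t, is_derive h t (h1 t)) -> h 0 = 0 ->
    exists c, 0 <= c <= t /\ h t = h1 c * t).
  { intros h h1 t Ht Hh h0.
    destruct (MVT_gen h 0 t h1) as [c [Hc E]].
    - intros; apply Hh.
    - intros x _. apply continuity_pt_filterlim.
      eapply continuous_of_is_derive, Hh.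
    - rewrite Rmin_left, Rmax_right in Hc by lra.
      exists c; split; [lra|]. rewrite h0 in E. lra. }
  intros t Ht.
  destruct (step g g1 t) as [c [Hc E]]; [lra|assumption|assumption|].
  destruct (step g1 g2 c) as [d [Hd E']]; [lra|assumption|assumption|].
  rewrite E, E', !Rabs_mult, (Rabs_right t), (Rabs_right c) by lra.
  pose proof (HM d ltac:(lra)). pose proof (Rabs_pos (g2 d)).
  simpl. rewrite Rmult_1_r, <- Rmult_assoc.
  apply Rmult_le_compat_r; [lra|].
  apply Rmult_le_compat; lra.
Qed.

(** From [x - x ^ 3 / 6 <= sin x]: on [0 <= x <= 2] this gives
    [x / 3 <= sin x], and [3 <= PI]. *)
Lemma sin_PI_mult_ge (t : R) : 0 <= t <= 1 / 2 -> t <= sin (PI * t).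
Proof.
  intros Ht.
  pose proof PI_4. pose proof PI2_3_2.
  assert (Hx : 0 <= PI * t <= 2) by nra.
  destruct (pre_sin_bound (PI * t) 0) as [H1 _]; [lra|lra|].
  unfold sin_approx, sin_term in H1. simpl in H1.
  assert (E : PI * t * (1 - (PI * t) * (PI * t) / 6) <= sin (PI * t)).
  { eapply Rle_trans; [|exact H1]. right. field. }
  assert (1 - (PI * t) * (PI * t) / 6 >= 1 / 3) by nra.
  nra.
Qed.

(** A function with a double zero at both ends is dominated by the square of
    the sine: near 0 it is quadratic and [t <= sin (PI t)], and the other half
    of the interval is its mirror image. *)
Lemma abs_le_sin_sqr (g g1 g2 : R -> R) :
  (forall t, is_derive g t (g1 t)) ->
  (forall t, is_derive g1 t (g2 t)) ->
  (forall t, continuous g2 t) ->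
  g 0 = 0 -> g1 0 = 0 -> g 1 = 0 -> g1 1 = 0 ->
  exists M, forall t, 0 <= t <= 1 -> Rabs (g t) <= M * sin (PI * t) ^ 2.
Proof.
  intros Hg Hg1 Hg2 g0 g10 g1' g11.
  destruct (continuity_ab_maj (fun t => Rabs (g2 t)) 0 1) as [x [Hx _]].
  { lra. }
  { intros c _. apply continuity_pt_filterlim.
    apply (continuous_comp g2 Rabs); [apply Hg2|apply continuous_Rabs]. }
  set (M := Rabs (g2 x)) in *. simpl in Hx.
  assert (HM0 : 0 <= M) by apply Rabs_pos.
  exists M. intros t Ht.
  assert (fin : forall s y, 0 <= s <= 1 / 2 -> Rabs y <= M * s ^ 2 ->
            Rabs y <= M * sin (PI * s) ^ 2).
  { intros s y Hs Hy. eapply Rle_trans; [exact Hy|].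
    apply Rmult_le_compat_l; [exact HM0|]. apply pow_incr.
    split; [lra|]. now apply sin_PI_mult_ge. }
  destruct (Rle_dec t (1 / 2)) as [Hh|Hh].
  - apply fin; [lra|].
    apply (abs_le_quadratic g g1 g2); auto.
  - replace (sin (PI * t)) with (sin (PI * (1 - t))).
    2:{ replace (PI * (1 - t)) with (PI - PI * t) by ring.
        now rewrite sin_PI_x. }
    apply fin; [lra|].
    replace (g t) with (g (1 - (1 - t))) by (f_equal; ring).
    apply (abs_le_quadratic (fun s => g (1 - s)) (fun s => - g1 (1 - s))
             (fun s => g2 (1 - s))); [| | | | |lra].
    + intros s. pose proof (is_derive_unique _ _ _ (Hg (1 - s))) as E.
      auto_derive; [eexists; apply Hg|].
      change (Derive (fun x => g x)) with (Derive g).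
      replace (1 + - s) with (1 - s) by ring. rewrite E. ring.
    + intros s. pose proof (is_derive_unique _ _ _ (Hg1 (1 - s))) as E.
      auto_derive; [eexists; apply Hg1|].
      change (Derive (fun x => g1 x)) with (Derive g1).
      replace (1 + - s) with (1 - s) by ring. rewrite E. ring.
    + intros s Hs. apply Hx. lra.
    + rewrite Rminus_0_r. exact g1'.
    + rewrite Rminus_0_r, g11. ring.
Qed.

(** Against a function dominated by [sin (PI t) ^ 2] the double-sum kernel
    integrates to a bounded quantity, so the averages of the partial sums tend
    to 0; by Cesaro these averages have the same limit [l] as the partial
    sums. *)
Lemma cos_series_zero (g : R -> R) (M : R) (a : nat -> R) (l : R) :
  (forall t, 0 <= t <= 1 -> Rabs (g t) <= M * sin (PI * t) ^ 2) ->
  (forall k, is_RInt (fun t => g t * cos (freq k * t)) 0 1 (a k)) ->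
  is_series a l -> l = 0.
Proof.
  intros HM Ha Hl.
  assert (HB : forall n, Rabs (sum_n (sum_n a) n) <= M / 2).
  { intros n.
    pose proof (is_RInt_sum_n _ _ 0 1 n
      (fun j => is_RInt_sum_n _ _ 0 1 j Ha)) as HI.
    replace (M / 2) with ((1 - 0) * (M / 2)) by ring.
    refine (norm_RInt_le_const _ _ _ _ _ Rle_0_1 _ HI).
    intros t Ht. change norm with Rabs.
    set (S2 := sum_n (fun j => sum_n (fun k => cos (freq k * t)) j) n).
    replace (sum_n _ n) with (g t * S2).
    2:{ unfold S2. symmetry.
        etransitivity; [|apply (sum_n_mult_l (K := R_Ring))].
        apply sum_n_ext; intros j. apply (sum_n_mult_l (K := R_Ring)). }
    rewrite Rabs_mult.
    apply Rle_trans with (M * (sin (PI * t) ^ 2 * Rabs S2)).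
    { rewrite <- Rmult_assoc. apply Rmult_le_compat_r; [apply Rabs_pos|auto]. }
    assert (HM0 : 0 <= M).
    { pose proof (HM (1 / 2) ltac:(lra)) as H.
      replace (PI * (1 / 2)) with (PI / 2) in H by field.
      rewrite sin_PI2 in H. pose proof (Rabs_pos (g (1 / 2))). lra. }
    apply Rmult_le_compat_l; [exact HM0|].
    pose proof (kernel_double_sum n t) as E. fold S2 in E.
    assert (E' : 4 * (sin (PI * t) ^ 2 * Rabs S2)
                 = Rabs (cos (PI * t) - cos (freq (S n) * t))).
    { rewrite <- E, !Rabs_mult, (Rabs_right 4) by lra.
      rewrite (Rabs_right (sin (PI * t) ^ 2)); [ring|].
      apply Rle_ge, pow2_ge_0. }
    assert (Rabs (cos (PI * t) - cos (freq (S n) * t)) <= 2).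
    { apply Rabs_le. pose proof (COS_bound (PI * t)).
      pose proof (COS_bound (freq (S n) * t)). lra. }
    lra. }
  assert (HC : Un_cv (fun n => sum_f_R0 (sum_n a) (pred n) / INR n) l).
  { apply Cesaro_1. apply is_lim_seq_Reals. exact Hl. }
  apply is_lim_seq_Reals in HC.
  assert (H0 : is_lim_seq (fun n => sum_f_R0 (sum_n a) (pred n) / INR n) 0).
  { apply is_lim_seq_abs_0.
    apply is_lim_seq_le_le with (fun _ => 0) (fun n => M / 2 * / INR n).
    - intros n. split; [apply Rabs_pos|].
      unfold Rdiv at 1. rewrite Rabs_mult, <- sum_n_Reals.
      assert (0 <= / INR n).
      { destruct n; [simpl; rewrite Rinv_0; lra|].
        left; apply Rinv_0_lt_compat, lt_0_INR; lia. }
      rewrite (Rabs_right (/ INR n)) by lra.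
      apply Rmult_le_compat_r; auto.
    - apply is_lim_seq_const.
    - replace (Finite 0) with (Rbar_mult (M / 2) 0) by (simpl; f_equal; ring).
      apply is_lim_seq_scal_l.
      apply (is_lim_seq_inv _ p_infty); [apply is_lim_seq_INR|discriminate]. }
  apply is_lim_seq_unique in HC. apply is_lim_seq_unique in H0.
  rewrite HC in H0. now injection H0.
Qed.

(** The coefficients of the constant, [cos (PI t)], [sin (PI t)] and
    [sin (2 PI t)]: these four functions interpolate arbitrary values and
    slopes at the two ends, and their coefficient series can be summed by
    hand. *)
Lemma cos_coef_cos (k : nat) :
  is_RInt (fun t => cos (PI * t) * cos (freq k * t)) 0 1
    (if Nat.eqb k 0 then 1 / 2 else 0).
Proof.
  pose proof PI_RGT_0 as HPI.
  destruct k as [|k]; simpl Nat.eqb; cbv iota.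
  - apply is_RInt_antiderivative with
      (fun t => (PI * t + sin (PI * t) * cos (PI * t)) / (2 * PI)).
    + intros t. unfold freq. simpl INR.
      replace (1 * PI * t) with (PI * t) by ring.
      auto_derive; [trivial|].
      replace (cos (PI * t) * cos (PI * t)) with (cos (PI * t) ^ 2) by ring.
      pose proof (sin2_cos2 (PI * t)) as E. unfold Rsqr in E.
      set (c := cos (PI * t)) in *. set (s := sin (PI * t)) in *.
      transitivity ((1 + c * c - s * s) / 2); [field; lra|].
      replace (s * s) with (1 - c * c) by (rewrite <- E; ring). field.
    + intros t.
      apply (ex_derive_continuous (K := R_AbsRing) (V := R_NormedModule)
        (fun t => cos (PI * t) * cos (freq 0 * t))). auto_derive; trivial.
    + rewrite Rmult_1_r, Rmult_0_r, sin_PI, sin_0. field. lra.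
  - eapply is_RInt_eq.
    + apply (cos_coef_harmonic _ (fun t => - PI * sin (PI * t)) PI).
      * unfold freq. rewrite INR_odd, S_INR. pose proof (pos_INR k). nra.
      * intros t; auto_derive; [trivial|ring].
      * intros t; auto_derive; [trivial|ring].
    + simpl. rewrite Rmult_1_r, Rmult_0_r, sin_PI, sin_0. unfold Rdiv; ring.
Qed.

Lemma cos_coef_sin (k : nat) :
  is_RInt (fun t => sin (PI * t) * cos (freq k * t)) 0 1 0.
Proof.
  pose proof PI_RGT_0 as HPI.
  destruct k as [|k].
  - apply is_RInt_antiderivative with (fun t => sin (PI * t) ^ 2 / (2 * PI)).
    + intros t. unfold freq. simpl INR.
      replace (1 * PI * t) with (PI * t) by ring.
      auto_derive; [trivial|]. field. lra.
    + intros t.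
      apply (ex_derive_continuous (K := R_AbsRing) (V := R_NormedModule)
        (fun t => sin (PI * t) * cos (freq 0 * t))). auto_derive; trivial.
    + rewrite Rmult_1_r, Rmult_0_r, sin_PI, sin_0. field. lra.
  - eapply is_RInt_eq.
    + apply (cos_coef_harmonic _ (fun t => PI * cos (PI * t)) PI).
      * unfold freq. rewrite INR_odd, S_INR. pose proof (pos_INR k). nra.
      * intros t; auto_derive; [trivial|ring].
      * intros t; auto_derive; [trivial|ring].
    + simpl. rewrite Rmult_1_r, Rmult_0_r, cos_PI, cos_0. unfold Rdiv; ring.
Qed.

Lemma odd_sqr_neq_4 (k : nat) : INR (2 * k + 1) ^ 2 - 4 <> 0.
Proof.
  rewrite INR_odd. intros H.
  destruct k as [|k]; [simpl in H; lra|].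
  rewrite S_INR in H. pose proof (pos_INR k). nra.
Qed.

Lemma cos_coef_sin2 (k : nat) :
  is_RInt (fun t => sin (2 * PI * t) * cos (freq k * t)) 0 1
    (- 4 / PI * / (INR (2 * k + 1) ^ 2 - 4)).
Proof.
  pose proof PI_RGT_0 as HPI. pose proof (odd_sqr_neq_4 k) as Hk.
  eapply is_RInt_eq.
  - apply (cos_coef_harmonic _ (fun t => 2 * PI * cos (2 * PI * t)) (2 * PI)).
    + unfold freq. intros E. apply Hk.
      apply Rmult_eq_reg_l with (PI ^ 2); [|nra]. nra.
    + intros t; auto_derive; [trivial|ring].
    + intros t; auto_derive; [trivial|ring].
  - rewrite !Rmult_1_r, Rmult_0_r, cos_2PI, cos_0. unfold freq.
    set (N := INR (2 * k + 1)) in *.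
    field. repeat split; [exact Hk|lra|]. intros E. apply Hk.
    apply Rmult_eq_reg_l with (PI ^ 2); [|nra]. lra.
Qed.

Lemma cos_coef_const (k : nat) :
  is_RInt (fun t => 1 * cos (freq k * t)) 0 1 0.
Proof.
  pose proof (freq_pos k).
  eapply is_RInt_eq.
  - apply (cos_coef_harmonic (fun _ => 1) (fun _ => 0) 0).
    + nra.
    + intros t; auto_derive; [trivial|ring].
    + intros t; auto_derive; [trivial|ring].
  - unfold Rdiv; ring.
Qed.

(** The terms telescope with step 2: [1 / (N ^ 2 - 4)] is a quarter of
    [1 / (N - 2) - 1 / (N + 2)], and the two initial terms -1 and 1 cancel. *)
Lemma is_series_inv_odd_sqr_minus_4 :
  is_series (fun k => / (INR (2 * k + 1) ^ 2 - 4)) 0.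
Proof.
  assert (E : forall n, sum_n (fun k => / (INR (2 * k + 1) ^ 2 - 4)) n
     = - / 4 * (/ (2 * INR n + 1) + / (2 * INR n + 3))).
  { induction n as [|n IH].
    - rewrite sum_O. simpl. field.
    - rewrite sum_Sn, IH. change plus with Rplus.
      pose proof (odd_sqr_neq_4 (S n)) as H.
      rewrite INR_odd, S_INR in *. pose proof (pos_INR n).
      refine (_ : @eq R _ _). field. repeat split; try lra; nra. }
  assert (L : forall c, 0 < c -> is_lim_seq (fun n => / (2 * INR n + c)) 0).
  { intros c Hc. apply (is_lim_seq_inv _ p_infty); [|discriminate].
    apply is_lim_seq_le_p_loc with INR; [|apply is_lim_seq_INR].
    exists 0%nat; intros n _. pose proof (pos_INR n). lra. }
  apply (is_lim_seq_ext (fun n => - / 4 * (/ (2 * INR n + 1) + / (2 * INR n + 3)))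
    _ 0 (fun n => eq_sym (E n))).
  replace (Finite 0) with (Rbar_mult (- / 4) (0 + 0)) by (simpl; f_equal; ring).
  apply is_lim_seq_scal_l. apply is_lim_seq_plus'; apply L; lra.
Qed.

Lemma is_series_delta0 (c : R) :
  is_series (fun k => if Nat.eqb k 0 then c else 0) c.
Proof.
  apply is_series_decr_1. simpl. change plus with Rplus. change opp with Ropp.
  replace (c + - c) with 0 by ring.
  change (is_lim_seq (sum_n (fun _ : nat => 0)) 0).
  apply (is_lim_seq_ext (fun _ => 0)); [|apply is_lim_seq_const].
  intros n. induction n as [|n IH]; [now rewrite sum_O|].
  rewrite sum_Sn, <- IH. change plus with Rplus. ring.
Qed.

Lemma is_series_zero : is_series (fun _ : nat => 0) 0.
Proof.
  apply (is_series_ext (fun k => if Nat.eqb k 0 then 0 else 0)).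
  - now intros [|k].
  - apply is_series_delta0.
Qed.

(** Subtracting the combination of the four interpolating functions that
    matches [f] and its slope at both ends leaves a function with double zeros,
    whose series sums to 0. Of the four, only [cos (PI t)] has a nonzero
    coefficient sum, namely 1 / 2, and it enters with weight
    [(f 0 - f 1) / 2]. *)
Lemma cos_series_endpoints (f f1 f2 : R -> R) (a : nat -> R) (l : R) :
  (forall t, is_derive f t (f1 t)) ->
  (forall t, is_derive f1 t (f2 t)) ->
  (forall t, continuous f2 t) ->
  (forall k, is_RInt (fun t => f t * cos (freq k * t)) 0 1 (a k)) ->
  is_series a l -> l = (f 0 - f 1) / 4.
Proof.
  intros Hf Hf1 Hf2 Ha Hl.
  pose proof PI_RGT_0 as HPI.
  (* The solution of the 4 x 4 linear system g 0 = g 1 = g1 0 = g1 1 = 0. *)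
  set (b0 := - ((f 0 + f 1) / 2)). set (b1 := - ((f 0 - f 1) / 2)).
  set (b2 := - ((f1 0 - f1 1) / (2 * PI))).
  set (b3 := - ((f1 0 + f1 1) / (4 * PI))).
  set (g := fun t => f t + (b0 * 1 + b1 * cos (PI * t) + b2 * sin (PI * t)
              + b3 * sin (2 * PI * t))).
  set (g1 := fun t => f1 t + (- b1 * PI * sin (PI * t) + b2 * PI * cos (PI * t)
              + b3 * (2 * PI) * cos (2 * PI * t))).
  set (g2 := fun t => f2 t + (- b1 * PI * (PI * cos (PI * t))
              - b2 * PI * (PI * sin (PI * t))
              - b3 * (2 * PI) * (2 * PI * sin (2 * PI * t)))).
  destruct (abs_le_sin_sqr g g1 g2) as [M HM].
  - intros t. apply (is_derive_plus f _ t (f1 t)); [apply Hf|].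
    auto_derive; [trivial|ring].
  - intros t. apply (is_derive_plus f1 _ t (f2 t)); [apply Hf1|].
    auto_derive; [trivial|ring].
  - intros t. apply (continuous_plus f2); [apply Hf2|].
    apply (ex_derive_continuous (K := R_AbsRing) (V := R_NormedModule)).
    auto_derive; trivial.
  - unfold g, b0, b1. rewrite !Rmult_0_r, sin_0, cos_0. field.
  - unfold g1, b2, b3. rewrite !Rmult_0_r, sin_0, cos_0. field. lra.
  - unfold g, b0, b1. rewrite !Rmult_1_r, sin_PI, cos_PI, sin_2PI. field.
  - unfold g1, b2, b3. rewrite !Rmult_1_r, sin_PI, cos_PI, cos_2PI. field. lra.
  - assert (Hz : l + (b0 * 0 + b1 * (1 / 2) + b2 * 0 + b3 * (- 4 / PI * 0)) = 0).
    2:{ unfold b1 in Hz. lra. }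
    apply (cos_series_zero g M (fun k => a k + (b0 * 0
       + b1 * (if Nat.eqb k 0 then 1 / 2 else 0)
       + b2 * 0 + b3 * (- 4 / PI * / (INR (2 * k + 1) ^ 2 - 4)))) _ HM).
    + intros k.
      pose proof (is_RInt_plus _ _ _ _ _ _
        (is_RInt_plus _ _ _ _ _ _
          (is_RInt_plus _ _ _ _ _ _
             (is_RInt_scal _ _ _ b0 _ (cos_coef_const k))
             (is_RInt_scal _ _ _ b1 _ (cos_coef_cos k)))
          (is_RInt_scal _ _ _ b2 _ (cos_coef_sin k)))
        (is_RInt_scal _ _ _ b3 _ (cos_coef_sin2 k))) as Hb.
      eapply is_RInt_ext; [|exact (is_RInt_plus _ _ _ _ _ _ (Ha k) Hb)].
      intros t _. unfold plus, scal, g; simpl. unfold mult; simpl. ring.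
    + pose proof is_series_zero as H0.
      exact (is_series_plus _ _ _ _ Hl
        (is_series_plus _ _ _ _
          (is_series_plus _ _ _ _
             (is_series_plus _ _ _ _
                (is_series_scal b0 _ _ H0)
                (is_series_scal b1 _ _ (is_series_delta0 (1 / 2))))
             (is_series_scal b2 _ _ H0))
          (is_series_scal b3 _ _
             (is_series_scal (- 4 / PI) _ _ is_series_inv_odd_sqr_minus_4)))).
Qed.

(** * The lambda function at integers *)

(** The partial sums of the case [p = 2] are at most [2 - 1 / (2 n + 1)],
    because [1 / N ^ 2 <= 1 / (N - 2) - 1 / N]; larger exponents give smaller
    terms. *)
Lemma ex_series_inv_odd_pow (p : nat) :
  (2 <= p)%nat -> ex_series (fun n => / INR (2 * n + 1) ^ p).
Proof.
  intros Hp.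
  apply (ex_series_le (K := R_AbsRing) (V := R_CompleteNormedModule) _
           (fun n => / INR (2 * n + 1) ^ 2)).
  { intros n. change norm with Rabs. pose proof (INR_odd_ge1 n).
    assert (0 < INR (2 * n + 1) ^ 2) by (apply pow_lt; lra).
    rewrite Rabs_right.
    - apply Rinv_le_contravar; [assumption|]. now apply Rle_pow.
    - left. apply Rinv_0_lt_compat, pow_lt; lra. }
  assert (Hpos : forall n, 0 < / INR (2 * n + 1) ^ 2).
  { intros n. pose proof (INR_odd_ge1 n). apply Rinv_0_lt_compat, pow_lt; lra. }
  assert (Hb : forall n, sum_n (fun n => / INR (2 * n + 1) ^ 2) n
                  <= 2 - / INR (2 * n + 1)).
  { induction n as [|n IH].
    - rewrite sum_O. simpl. lra.
    - rewrite sum_Sn. change plus with Rplus.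
      apply Rle_trans with (2 - / INR (2 * n + 1) + / INR (2 * S n + 1) ^ 2).
      { now apply Rplus_le_compat_r. }
      rewrite !INR_odd, S_INR. pose proof (pos_INR n). set (x := INR n) in *.
      assert (E : 2 - / (2 * (x + 1) + 1)
        - (2 - / (2 * x + 1) + / (2 * (x + 1) + 1) ^ 2)
        = (2 * x + 5) / ((2 * x + 1) * (2 * x + 3) ^ 2)) by (field; split; lra).
      assert (0 < (2 * x + 5) / ((2 * x + 1) * (2 * x + 3) ^ 2)).
      { apply Rdiv_lt_0_compat; [lra|].
        apply Rmult_lt_0_compat; [lra|apply pow_lt; lra]. }
      lra. }
  destruct (ex_finite_lim_seq_incr (sum_n (fun n => / INR (2 * n + 1) ^ 2)) 2)
    as [l Hl].
  - intros n. rewrite sum_Sn. change plus with Rplus.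
    pose proof (Hpos (S n)). lra.
  - intros n. pose proof (Hb n). pose proof (INR_odd_ge1 n).
    assert (0 < / INR (2 * n + 1)) by (apply Rinv_0_lt_compat; lra). lra.
  - exists l. exact Hl.
Qed.

Definition lambdaR (p : nat) : R := Series (fun n => / INR (2 * n + 1) ^ p).

Lemma is_series_lambdaR (p : nat) :
  (2 <= p)%nat -> is_series (fun n => / INR (2 * n + 1) ^ p) (lambdaR p).
Proof. intros Hp. apply Series_correct. now apply ex_series_inv_odd_pow. Qed.

(** The neighbourhoods of a complex number are products of real ones. *)
Lemma is_series_RtoC (a : nat -> R) (l : R) :
  is_series a l ->
  is_series (V := C_NormedModule) (fun n => RtoC (a n)) (RtoC l).
Proof.
  intros H.
  assert (E : forall n, RtoC (sum_n a n)
                = sum_n (G := C_NormedModule) (fun n => RtoC (a n)) n).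
  { induction n as [|n IH]; [now rewrite !sum_O|].
    rewrite !sum_Sn, <- IH. apply RtoC_plus. }
  unfold is_series.
  apply filterlim_ext with (1 := E).
  apply (filterlim_comp _ _ _ (sum_n a) RtoC _ (locally l)); [exact H|].
  intros P [eps HP]. exists eps. intros y Hy. apply HP.
  split; [exact Hy|apply ball_center].
Qed.

Lemma lambda_nat (p : nat) :
  (2 <= p)%nat -> lambda (RtoC (INR p)) = RtoC (lambdaR p).
Proof.
  intros Hp. apply lambda_unique.
  eapply is_series_ext; [|apply is_series_RtoC, is_series_lambdaR, Hp].
  intros n. cbv beta. pose proof (INR_odd_ge1 n).
  rewrite RpowerC_nat by lra. rewrite <- RtoC_pow, <- RtoC_div.
  - f_equal. unfold Rdiv. now rewrite Rmult_1_l.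
  - apply pow_nonzero. lra.
Qed.

(** * Cosine coefficients of Appell sequences *)

(** Each double integration by parts lowers the index by 2, releases the end
    values of one odd-indexed member, and divides by [- freq k ^ 2]; the
    process stops at the constant [u 0], whose coefficients vanish. *)
Lemma cos_coef_appell (u : nat -> R -> R) (m k : nat) :
  (forall j t, is_derive (u (S j)) t (u j t)) ->
  (forall t, u O t = u O 0) ->
  is_RInt (fun t => u (2 * m)%nat t * cos (freq k * t)) 0 1
    ((-1) ^ (m + 1) * sum_n_m (fun i => (-1) ^ i
        * (u (2 * i - 1)%nat 1 + u (2 * i - 1)%nat 0)
        / freq k ^ (2 * m - 2 * i + 2)) 1 m).
Proof.
  intros Hu Hu0. pose proof (freq_pos k) as Hk.
  assert (Hc : forall j t, continuous (u j) t).
  { intros [|j] t.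
    - apply (continuous_ext (fun _ => u O 0)); [now intros; symmetry|].
      apply continuous_const.
    - eapply continuous_of_is_derive, Hu. }
  induction m as [|m IH].
  - rewrite sum_n_m_zero by lia. simpl.
    eapply is_RInt_ext.
    2:{ eapply is_RInt_eq; [apply (is_RInt_scal _ _ _ (u O 0) _ (cos_coef_const k))|].
        unfold scal, zero; simpl; unfold mult; simpl. ring. }
    intros t _. unfold scal; simpl; unfold mult; simpl. rewrite (Hu0 t). ring.
  - replace (2 * S m)%nat with (S (S (2 * m))) by lia.
    eapply is_RInt_eq.
    { apply (cos_coef_reduce _ (u (S (2 * m))) (u (2 * m)%nat));
        [apply Hu|apply Hu|apply Hc|exact IH]. }
    set (S0 := sum_n_m _ 1 m).
    rewrite sum_n_Sm by lia. change plus with Rplus.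
    replace (2 * S m - 1)%nat with (S (2 * m)) by lia.
    replace (S (S (2 * m)) - 2 * S m + 2)%nat with 2%nat by lia.
    rewrite (sum_n_m_ext_loc _ (fun i => mult (/ freq k ^ 2) ((-1) ^ i
        * (u (2 * i - 1)%nat 1 + u (2 * i - 1)%nat 0)
        / freq k ^ (2 * m - 2 * i + 2))) 1 m).
    2:{ intros i Hi.
        replace (S (S (2 * m)) - 2 * i + 2)%nat
          with (2 * m - 2 * i + 2 + 2)%nat by lia.
        rewrite (pow_add _ (2 * m - 2 * i + 2) 2). unfold mult; simpl mult. cbn -[pow freq Nat.mul INR].
        field. split; [|lra]. apply pow_nonzero. lra. }
    rewrite (sum_n_m_mult_l (K := R_Ring)).
    change (sum_n_m _ 1 m) with S0. change mult with Rmult.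
    replace (S m + 1)%nat with (S (m + 1)) by lia.
    replace ((-1) ^ S m) with ((-1) ^ (m + 1)) by (f_equal; lia).
    assert (E : (-1) ^ (m + 1) * (-1) ^ (m + 1) = 1).
    { rewrite <- pow_add. replace (m + 1 + (m + 1))%nat with (2 * (m + 1))%nat by lia.
      apply pow_1_even. }
    change ((-1) ^ S (m + 1)) with (-1 * (-1) ^ (m + 1)).
    transitivity (((-1) ^ (m + 1) * (-1) ^ (m + 1)) * - (u (S (2 * m)) 1 + u (S (2 * m)) 0) / freq k ^ 2
      - (-1) ^ (m + 1) * S0 / freq k ^ 2).
    + rewrite E. field. lra.
    + field. lra.
Qed.

Lemma is_series_sum_n_m (a : nat -> nat -> R) (l : nat -> R) (p m : nat) :
  (forall i, (p <= i <= m)%nat -> is_series (a i) (l i)) ->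
  is_series (fun k => sum_n_m (fun i => a i k) p m) (sum_n_m l p m).
Proof.
  intros H.
  pose proof is_series_zero as H0.
  induction m as [|m IH].
  - destruct p as [|p].
    + rewrite sum_n_n. eapply is_series_ext; [|apply H; lia].
      intros k. now rewrite sum_n_n.
    + rewrite sum_n_m_zero by lia. eapply is_series_ext; [|exact H0].
      intros k. now rewrite sum_n_m_zero by lia.
  - destruct (Compare_dec.le_lt_dec p (S m)) as [Hpm|Hpm].
    + assert (IH' := IH (fun i Hi => H i ltac:(lia))).
      rewrite sum_n_Sm by lia. eapply is_series_ext.
      2:{ exact (is_series_plus _ _ _ _ IH' (H (S m) ltac:(lia))). }
      intros k. now rewrite sum_n_Sm by lia.
    + rewrite sum_n_m_zero by lia. eapply is_series_ext; [|exact H0].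
      intros k. now rewrite sum_n_m_zero by lia.
Qed.

(** The two evaluations of the same series: term by term through
    [cos_coef_appell], where each power of [1 / freq k] sums to a lambda
    value, and globally through [cos_series_endpoints]. *)
Lemma lambdaR_appell (u : nat -> R -> R) (m : nat) :
  (forall j t, is_derive (u (S j)) t (u j t)) ->
  (forall t, u O t = u O 0) -> (1 <= m)%nat ->
  (-1) ^ (m + 1) * sum_n_m (fun i => (-1) ^ i
        * (u (2 * i - 1)%nat 1 + u (2 * i - 1)%nat 0)
        * lambdaR (2 * m - 2 * i + 2) / PI ^ (2 * m - 2 * i + 2)) 1 m
  = (u (2 * m)%nat 0 - u (2 * m)%nat 1) / 4.
Proof.
  intros Hu Hu0 Hm. pose proof PI_RGT_0 as HPI.
  destruct m as [|m]; [lia|].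
  refine (cos_series_endpoints (u (2 * S m)%nat) (u (S (2 * m))) (u (2 * m)%nat) _ _
    _ _ _ (fun k => cos_coef_appell u (S m) k Hu Hu0) _).
  - replace (2 * S m)%nat with (S (S (2 * m))) by lia. apply Hu.
  - apply Hu.
  - intros t. destruct m as [|m].
    + apply (continuous_ext (fun _ => u O 0)); [now intros; symmetry|].
      apply continuous_const.
    + replace (2 * S m)%nat with (S (S (2 * m))) by lia.
      eapply continuous_of_is_derive, Hu.
  - apply (is_series_scal_l (K := R_AbsRing) (V := R_NormedModule) ((-1) ^ (S m + 1))).
    apply is_series_sum_n_m. intros i Hi.
    set (p := (2 * S m - 2 * i + 2)%nat).
    set (c := (-1) ^ i * (u (2 * i - 1)%nat 1 + u (2 * i - 1)%nat 0)).
    assert (Hp : (2 <= p)%nat) by (unfold p; lia).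
    replace (c * lambdaR p / PI ^ p) with (scal (c / PI ^ p) (lambdaR p)).
    2:{ unfold scal; simpl; unfold mult; simpl. field. apply pow_nonzero; lra. }
    eapply is_series_ext;
      [|exact (is_series_scal_l (c / PI ^ p) _ _ (is_series_lambdaR p Hp))].
    intros k. pose proof (INR_odd_ge1 k).
    unfold freq. rewrite Rpow_mult_distr.
    unfold scal; cbn -[pow INR Nat.mul]; unfold mult; cbn -[pow INR Nat.mul].
    field. split; apply pow_nonzero; lra.
Qed.

(** * Real parts of complex powers *)

Lemma is_derive_eq (f : R -> R) (t d d' : R) :
  is_derive f t d -> d = d' -> is_derive f t d'.
Proof. now intros H <-. Qed.

Lemma is_derive_affine_comb (P Q : R -> R) (x y t p q : R) :
  is_derive P t p -> is_derive Q t q ->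
  is_derive (fun s => (x + s) * P s + y * Q s) t (P t + (x + t) * p + y * q).
Proof.
  intros HP HQ.
  pose proof (is_derive_unique _ _ _ HP) as EP.
  pose proof (is_derive_unique _ _ _ HQ) as EQ.
  auto_derive.
  - repeat split; eexists; eassumption.
  - change (Derive (fun s => P s)) with (Derive P).
    change (Derive (fun s => Q s)) with (Derive Q).
    rewrite EP, EQ. ring.
Qed.

(** The real and imaginary parts are treated together, since the product rule
    for one involves the other. *)
Lemma is_derive_Cpow_shift (beta : C) (j : nat) (t : R) :
  is_derive (fun s => Re ((beta + RtoC s) ^ S j)%C) t
    (INR (S j) * Re ((beta + RtoC t) ^ j)%C) /\
  is_derive (fun s => Im ((beta + RtoC s) ^ S j)%C) t
    (INR (S j) * Im ((beta + RtoC t) ^ j)%C).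
Proof.
  destruct beta as [x y].
  induction j as [|j [IHr IHi]].
  - split; simpl; auto_derive; trivial; ring.
  - rewrite S_INR. split.
    + eapply is_derive_ext.
      2:{ eapply is_derive_eq; [exact (is_derive_affine_comb _ _ x (- y) t _ _ IHr IHi)|].
          cbv beta. simpl Cpow. unfold Re, Im; simpl fst; simpl snd. ring. }
      intros s. simpl Cpow. unfold Re, Im; simpl. ring.
    + eapply is_derive_ext.
      2:{ eapply is_derive_eq; [exact (is_derive_affine_comb _ _ x y t _ _ IHi IHr)|].
          cbv beta. simpl Cpow. unfold Re, Im; simpl fst; simpl snd.  ring. }
      intros s. simpl Cpow. unfold Re, Im; simpl. ring.
Qed.

(** The real weight-[w] component of the Appell sequence
    [(beta + t) ^ j / j!]. Letting [w] vary gives access to the real and the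
    imaginary part at once. *)
Definition divided_power (w beta : C) (j : nat) (t : R) : R :=
  Re (w * (beta + RtoC t) ^ j)%C / INR (fact j).

Lemma is_derive_divided_power (w beta : C) (j : nat) (t : R) :
  is_derive (divided_power w beta (S j)) t (divided_power w beta j t).
Proof.
  destruct (is_derive_Cpow_shift beta j t) as [Hr Hi].
  eapply is_derive_ext.
  2:{ eapply is_derive_eq.
      - exact (is_derive_scal_l _ t _ (/ INR (fact (S j)))
          (is_derive_minus _ _ t _ _ (is_derive_scal _ t (Re w) _ Hr)
                                     (is_derive_scal _ t (Im w) _ Hi))).
      - unfold divided_power.
        set (z := ((beta + RtoC t) ^ j)%C).
        change (Re (w * z)%C) with (Re w * Re z - Im w * Im z).
        rewrite fact_simpl, mult_INR.
        pose proof (INR_fact_neq_0 j). pose proof (not_0_INR (S j) ltac:(lia)).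
        set (N := INR (S j)) in *. set (F := INR (fact j)) in *.
        unfold scal, minus, plus, opp; simpl. unfold mult; simpl.
                field. now split. }
  intros s. reflexivity.
Qed.

Lemma Re_mult_RtoC (w z : C) (r : R) :
  Re (w * (RtoC r * z))%C = r * Re (w * z)%C.
Proof. unfold Re; simpl. ring. Qed.

Lemma Re_mult_sum_n_m (w : C) (z : nat -> C) (p q : nat) :
  Re (w * sum_n_m z p q)%C = sum_n_m (fun k => Re (w * z k)%C) p q.
Proof.
  induction q as [|q IH].
  - destruct p as [|p].
    + now rewrite !sum_n_n.
    + rewrite !sum_n_m_zero by lia. unfold Re, zero; simpl. ring.
  - destruct (Compare_dec.le_lt_dec p (S q)) as [H|H].
    + rewrite !sum_n_Sm, <- IH by lia. unfold Re, plus; simpl. ring.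
    + rewrite !sum_n_m_zero by lia. unfold Re, zero; simpl. ring.
Qed.

Lemma Ceq_0_of_Re_mult (z : C) : (forall w : C, Re (w * z)%C = 0) -> z = RtoC 0.
Proof.
  intros H. pose proof (H (RtoC 1)) as H1. pose proof (H Ci) as H2.
  destruct z as [x y]. unfold Re in *; simpl in *. apply injective_projections; simpl; lra.
Qed.

(** * The recurrence *)

Theorem theorem1p2 (m : nat) (alpha : C)
  (hm : (1 <= m)%nat) (halpha : alpha <> RtoC (1 / 2)) :
  ((- 1) ^ (m + 1) * ((alpha ^ (2 * m) - (alpha - 1) ^ (2 * m)) / 4)
     * (RtoC PI ^ (2 * m + 2) / RtoC (INR (fact (2 * m))))
   + sum_n_m (fun k : nat =>
       (- 1) ^ k * (alpha ^ (2 * k - 1) + (alpha - 1) ^ (2 * k - 1))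
         * (RtoC PI ^ (2 * k) / RtoC (INR (fact (2 * k - 1))))
         * lambda (RtoC (INR (2 * m - 2 * k + 2)))) 1 m
   = 0)%C.
Proof.
  pose proof PI_RGT_0 as HPI.
  assert (Hfact : forall n, RtoC (INR (fact n)) <> 0%C).
  { intros n E. apply (INR_fact_neq_0 n). now apply RtoC_inj in E. }
  apply Ceq_0_of_Re_mult. intros w.
  rewrite (sum_n_m_ext_loc _ (fun k : nat =>
    (RtoC ((-1) ^ k * PI ^ (2 * k) / INR (fact (2 * k - 1))
           * lambdaR (2 * m - 2 * k + 2))
     * (alpha ^ (2 * k - 1) + (alpha - 1) ^ (2 * k - 1)))%C) 1 m).
  2:{ intros k Hk. rewrite lambda_nat by lia.
      rewrite !RtoC_mult, RtoC_div, RtoC_mult, !RtoC_pow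
        by apply INR_fact_neq_0.
      refine (_ : @eq C _ _). field. apply Hfact. }
  replace ((- 1) ^ (m + 1) * ((alpha ^ (2 * m) - (alpha - 1) ^ (2 * m)) / 4)
     * (RtoC PI ^ (2 * m + 2) / RtoC (INR (fact (2 * m)))))%C
    with (RtoC ((-1) ^ (m + 1) * PI ^ (2 * m + 2) / 4 / INR (fact (2 * m)))
          * (alpha ^ (2 * m) - (alpha - 1) ^ (2 * m)))%C.
  2:{ rewrite !RtoC_div, RtoC_mult, !RtoC_pow;
        [|lra|apply INR_fact_neq_0].
      field. apply Hfact. }
  rewrite Cmult_plus_distr_l, re_plus, Re_mult_sum_n_m, Re_mult_RtoC.
  set (u := divided_power w (alpha - 1)).
  assert (Hu1 : forall j, Re (w * alpha ^ j)%C = INR (fact j) * u j 1).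
  { intros j. unfold u, divided_power.
    replace (alpha - 1 + 1)%C with alpha by ring.
    field. apply INR_fact_neq_0. }
  assert (Hu0 : forall j, Re (w * (alpha - 1) ^ j)%C = INR (fact j) * u j 0).
  { intros j. unfold u, divided_power.
    replace (alpha - 1 + 0)%C with (alpha - 1)%C by ring.
    field. apply INR_fact_neq_0. }
  pose proof (lambdaR_appell u m (is_derive_divided_power w (alpha - 1))
    (fun t => eq_refl) hm) as H.
  set (S0 := sum_n_m _ 1 m) in H.
  replace (sum_n_m _ 1 m) with (PI ^ (2 * m + 2) * S0).
  2:{ unfold S0. etransitivity; [symmetry; apply (sum_n_m_mult_l (K := R_Ring))|].
      apply sum_n_m_ext_loc. intros k Hk.
      rewrite Re_mult_RtoC, Cmult_plus_distr_l, re_plus, Hu1, Hu0.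
      replace (2 * m + 2)%nat with (2 * k + (2 * m - 2 * k + 2))%nat by lia.
      rewrite pow_add. change mult with Rmult.
      set (p := (2 * m - 2 * k + 2)%nat).
      refine (_ : @eq R _ _). field.
      split; [apply INR_fact_neq_0|apply pow_nonzero; lra]. }
  replace (Re (w * (alpha ^ (2 * m) - (alpha - 1) ^ (2 * m)))%C)
    with (INR (fact (2 * m)) * (u (2 * m)%nat 1 - u (2 * m)%nat 0)).
  2:{ rewrite Rmult_minus_distr_l, <- Hu1, <- Hu0. unfold Re; simpl; ring. }
  assert (E : (-1) ^ (m + 1) * (-1) ^ (m + 1) = 1).
  { rewrite <- pow_add. replace (m + 1 + (m + 1))%nat with (2 * (m + 1))%nat by lia.
    apply pow_1_even. }
  set (X := (-1) ^ (m + 1)) in *.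
  (* X is a sign, so it may be moved across the equation H. *)
  assert (E' : S0 = X * ((u (2 * m)%nat 0 - u (2 * m)%nat 1) / 4)).
  { rewrite <- H, <- Rmult_assoc, E. symmetry. apply Rmult_1_l. }
  rewrite E'. field. apply INR_fact_neq_0.
Qed.
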